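(* Let $T>0$ and $r>0$ be fixed with $0<r<1-T$, and let $u_0:\mathbb{R}^2\to\mathbb{R}$ be given by $u_0(x,y)=1$ if $x^2+y^2\le r^2$ and $u_0(x,y)=0$ if $x^2+y^2>r^2$. Define the Eulerian solution manifold $$\mathcal{M}_E=\{\,(x,y)\mapsto u_0(x-t\cos\theta,\,y-t\sin\theta) : \theta\in[0,2\pi],\ t\in[0,T]\,\}\subset L^2([-1,1]^2)$$ and the Lagrangian solution manifold $$\mathcal{M}_L=\left\{\ (\hat{x},\hat{y})\mapsto\begin{pmatrix}\hat{x}+t\cos\theta\\ \hat{y}+t\sin\theta\\ u_0(\hat{x},\hat{y})\end{pmatrix} : \theta\in[0,2\pi],\ t\in[0,T]\right\}\subset L^2([-1,1]^2;\mathbb{R}^3).$$ Then there exists a constant $c>0$ such that for all integers $n\ge 1$, $$d_n(\mathcal{M}_E)\ge c\,n^{-1/2},$$ and, in addition, $$d_n(\mathcal{M}_L)=0\qquad\text{for all integers } n\ge 3.$$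
   Context: For a subset $\mathcal{M}$ of a normed space $X$, the Kolmogorov $n$-width of $\mathcal{M}$ in $X$ is $$d_n(\mathcal{M})=\inf_{\substack{\mathcal{V}_n\subset X\\ \dim \mathcal{V}_n=n}}\ \sup_{u\in\mathcal{M}}\ \inf_{v\in\mathcal{V}_n}\|u-v\|_X,$$ the outer infimum being over $n$-dimensional linear subspaces. Here $X=L^2([-1,1]^2)$ for $\mathcal{M}_E$ and $X=L^2([-1,1]^2;\mathbb{R}^3)$ for $\mathcal{M}_L$, the latter with norm $\|(v_1,v_2,v_3)\|=\left(\int_{-1}^1\int_{-1}^1[v_1^2+v_2^2+v_3^2]\,d\hat{x}\,d\hat{y}\right)^{1/2}$. Background: $\mathcal{M}_E$ is the set of solutions of $\partial_t u+\cos\theta\,\partial_x u+\sin\theta\,\partial_y u=0$ on $[-1,1]^2\times[0,T]$ with initial datum $u_0$ and zero boundary values on the boundary of $[-1,1]^2$; $\mathcal{M}_L$ collects the characteristic lines $\hat{x}+t\cos\theta$, $\hat{y}+t\sin\theta$ together with the solution value along them. *)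

(* Defs.v *)
From HB Require Import structures.
From mathcomp Require Import all_boot all_order all_algebra.
From mathcomp Require Import generic_quotient ring_quotient.
From mathcomp Require Import ring lra.
From mathcomp Require Import all_classical all_reals all_analysis.
From mathcomp Require Import measurable_realfun.

Set Implicit Arguments.
Unset Strict Implicit.
Unset Printing Implicit Defensive.

Import Order.TTheory GRing.Theory Num.Theory.
Import numFieldNormedType.Exports.

Local Open Scope classical_set_scope.
Local Open Scope ring_scope.
Local Open Scope quotient_scope.

Section seminorm_quotient.
Context (R : numFieldType) (V : lmodType R).

Record seminorm := Seminorm {
  snorm :> V -> R ;
  ler_snormD : forall x y, snorm (x + y) <= snorm x + snorm y ;
  snormZ : forall (a : R) x, snorm (a *: x) = `|a| * snorm x }.

Variable p : seminorm.

(* [snquot] is V / {x | p x = 0}, a normed module under the norm induced by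
   p; the quotient map is [\pi_snquot]. *)
Definition snull : {pred V} := [pred x | p x == 0].

Lemma snorm0 : p 0 = 0.
Proof. by rewrite -(scale0r 0) snormZ normr0 mul0r. Qed.

Lemma snormN x : p (- x) = p x.
Proof. by rewrite -scaleN1r snormZ normrN1 mul1r. Qed.

Lemma snorm_ge0 x : 0 <= p x.
Proof.
have := ler_snormD p x (- x).
by rewrite subrr snorm0 snormN -mulr2n pmulrn_lge0.
Qed.

Let snull_submod : submod_closed snull.
Proof.
split; rewrite ?inE ?snorm0// => a x y; rewrite !inE => /eqP px /eqP py.
rewrite eq_le snorm_ge0 andbT (le_trans (ler_snormD _ _ _))//.
by rewrite snormZ px py mulr0 addr0.
Qed.

HB.instance Definition _ := GRing.isSubmodClosed.Build R V snull snull_submod.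

Definition snquot : Type := Quotient.quot snull.
HB.instance Definition _ := Choice.on snquot.
HB.instance Definition _ := EqQuotient.on snquot.
HB.instance Definition _ := GRing.Zmodule.on snquot.


Lemma snquot_eqP (x y : V) :
  reflect (p (x - y) = 0) (\pi_snquot x == \pi_snquot y :> snquot).
Proof. by rewrite -Quotient.idealrBE inE; exact: eqP. Qed.

Definition snq_scale (a : R) := lift_op1 snquot ( *:%R a).

Lemma pi_snq_scale a : {morph \pi_snquot : x / a *: x >-> snq_scale a x}.
Proof.
move=> x; unlock snq_scale; apply/eqP/snquot_eqP.
rewrite -scalerBr snormZ; apply/eqP; rewrite mulf_eq0; apply/orP; right.
by apply/eqP/snquot_eqP; rewrite reprK.
Qed.

Let snq_scalerA a b v : snq_scale a (snq_scale b v) = snq_scale (a * b) v.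
Proof. by rewrite -[v]reprK -!pi_snq_scale scalerA. Qed.

Let snq_scale1r : left_id 1 snq_scale.
Proof. by move=> v; rewrite -[v]reprK -pi_snq_scale scale1r. Qed.

Lemma pi_snqD : {morph \pi_snquot : x y / x + y >-> x + y}.
Proof. exact: Quotient.pi_add. Qed.

Let snq_scalerDr : right_distributive snq_scale +%R.
Proof.
move=> a u v; rewrite -[u]reprK -[v]reprK.
by rewrite -pi_snqD -!pi_snq_scale -pi_snqD scalerDr.
Qed.

Let snq_scalerDl v : {morph snq_scale^~ v : a b / a + b}.
Proof.
by move=> a b; rewrite -[v]reprK -!pi_snq_scale -pi_snqD scalerDl.
Qed.

HB.instance Definition _ := GRing.Zmodule_isLmodule.Build R snquot
  snq_scalerA snq_scale1r snq_scalerDr snq_scalerDl.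

Definition snq_norm := lift_fun1 snquot p.

Lemma pi_snq_norm x : snq_norm (\pi_snquot x) = p x.
Proof.
unlock snq_norm; set y := repr _.
have pyx : p (y - x) = 0 by apply/snquot_eqP; rewrite reprK.
have pxy : p (x - y) = 0 by rewrite -opprB snormN.
apply/eqP; rewrite eq_le; apply/andP; split.
  by have := ler_snormD p (y - x) x; rewrite subrK pyx add0r.
by have := ler_snormD p (x - y) y; rewrite subrK pxy add0r.
Qed.

Let ler_snq_normD x y : snq_norm (x + y) <= snq_norm x + snq_norm y.
Proof.
by rewrite -[x]reprK -[y]reprK -pi_snqD !pi_snq_norm ler_snormD.
Qed.

Let snq_normZ (a : R) x : snq_norm (a *: x) = `|a| * snq_norm x.
Proof.
by rewrite -[x]reprK -[a *: _]pi_snq_scale !pi_snq_norm snormZ.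
Qed.

Let snq_norm0_eq0 x : snq_norm x = 0 -> x = 0.
Proof.
rewrite -[x]reprK pi_snq_norm => px0.
have -> : 0 = \pi_snquot 0 :> snquot 
  by apply: (@addrI _ (\pi_snquot 0)); rewrite addr0 -pi_snqD addr0.
by apply/eqP/snquot_eqP; rewrite subr0.
Qed.

HB.instance Definition _ := Lmodule_isNormed.Build R snquot
  ler_snq_normD snq_normZ snq_norm0_eq0.

End seminorm_quotient.

Lemma sqrt_sum_sqrD (R : rcfType) (I : finType) (a b : I -> R) :
  Num.sqrt (\sum_i (a i + b i) ^+ 2) <=
  Num.sqrt (\sum_i a i ^+ 2) + Num.sqrt (\sum_i b i ^+ 2).
Proof.
set A := Num.sqrt (\sum_i a i ^+ 2); set B := Num.sqrt (\sum_i b i ^+ 2).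
have sqA : A ^+ 2 = \sum_i a i ^+ 2.
  by rewrite sqr_sqrtr// sumr_ge0// => i _; exact: sqr_ge0.
have sqB : B ^+ 2 = \sum_i b i ^+ 2.
  by rewrite sqr_sqrtr// sumr_ge0// => i _; exact: sqr_ge0.
have A0 : 0 <= A by exact: sqrtr_ge0.
have B0 : 0 <= B by exact: sqrtr_ge0.
have CS : \sum_i a i * b i <= A * B.
  have sum0 (c e : I -> R) : \sum_i c i ^+ 2 = 0 -> \sum_i c i * e i = 0.
    move=> c0; apply: big1 => i _; suff -> : c i = 0 by rewrite mul0r.
    apply/eqP; rewrite -sqrf_eq0; apply/eqP.
    by apply: (psumr_eq0P _ c0) => // j _; exact: sqr_ge0.
  have [A_eq0|A_neq0] := eqVneq A 0.
    by rewrite A_eq0 mul0r sum0// -sqA A_eq0 expr0n.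
  have [B_eq0|B_neq0] := eqVneq B 0.
    under eq_bigr do rewrite mulrC.
    by rewrite B_eq0 mulr0 sum0// -sqB B_eq0 expr0n.
  have AB0 : 0 < A * B by rewrite mulr_gt0// lt_neqAle eq_sym ?A_neq0 ?B_neq0.
  have : 0 <= \sum_i (B * a i - A * b i) ^+ 2.
    by rewrite sumr_ge0// => i _; exact: sqr_ge0.
  have -> : \sum_i (B * a i - A * b i) ^+ 2 =
      2 * (A * B) * (A * B - \sum_i a i * b i).
    rewrite [LHS](_ : _ = \sum_i (B ^+ 2 * a i ^+ 2 - 2 * (A * B) * (a i * b i)
        + A ^+ 2 * b i ^+ 2)); last by apply: eq_bigr => i _; ring.
    rewrite !big_split/= sumrN -!mulr_sumr -sqA -sqB; ring.
  have AB20 : 0 < 2 * (A * B) by rewrite mulr_gt0.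
  by rewrite (pmulr_rge0 _ AB20) subr_ge0.
rewrite -(@ler_pXn2r _ 2)// ?nnegrE ?addr_ge0// ?sqrtr_ge0//.
rewrite sqr_sqrtr; last by rewrite sumr_ge0// => i _; exact: sqr_ge0.
under eq_bigr do rewrite sqrrD.
by rewrite !big_split/= sqrrD sqA sqB !lerD2r lerD2l -mulr2n lerMn2r CS.
Qed.

Section L2.
Context d (T : measurableType d) (R : realType).
Variable mu : {measure set T -> \bar R}.

(* [L2 mu] is L^2(mu; R); [vL2 mu m] is L^2(mu; R^m), whose norm uses the
   Euclidean norm of R^m and not the max norm that the library puts on
   'rV[R]_m. *)
Definition L2norm (f : LfunType mu (lee1n 2)) : R := fine 'N[mu]_2[EFin \o f].

Let L2normZ (a : R) f : L2norm (a *: f) = `|a| * L2norm f.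
Proof. by apply: EFin_inj; rewrite EFinM !finite_norm_fine LnormZ. Qed.

Definition L2seminorm : seminorm (LfunType mu (lee1n 2)) :=
  Seminorm (@ler_LnormD _ _ _ _ _ _) L2normZ.

Definition L2 : Type := snquot L2seminorm.
HB.instance Definition _ := NormedModule.on L2.

Definition L2class (f : LfunType mu (lee1n 2)) : L2 :=
  \pi_(snquot L2seminorm) f.

Lemma L2class_norm f : `|L2class f| = L2norm f.
Proof. exact: pi_snq_norm. Qed.

Lemma L2class_eqP (f g : LfunType mu (lee1n 2)) :
  L2class f = L2class g <-> f = g %[ae mu].
Proof.
split=> [/eqP/snquot_eqP/fine_Lnormr_eq0|fg].
  apply: filterS => x /(_ Logic.I) /= + _.
  by move=> /eqP; rewrite subr_eq0 => /eqP.
apply/eqP/snquot_eqP => /=; rewrite /L2norm unlock /=.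
have mfg : measurable_fun [set: T] (fun x => f x - g x).
  exact: measurable_funB.
rewrite (ae_eq_integral (cst 0%E))//=.
- by rewrite integral0 poweR0r//= invr_neq0.
- apply/measurable_EFinP/(measurableT_comp (measurable_powR _)).
  exact: measurableT_comp.
- apply: filterS fg => x /(_ Logic.I) /= fgx _.
  by rewrite [X in `|X|](_ : _ = f x - g x)// fgx subrr normr0 powR0.
Qed.

Context (m : nat).

Definition sqint : {pred T -> 'rV[R]_m} :=
  [pred f : T -> 'rV[R]_m | [forall i, (fun z => f z 0 i) \in Lfun mu 2]].

Let sqint_submod : submod_closed sqint.
Proof.
have [L0 LD] := @Lfun_submod_closed _ _ _ mu 2 (lee1n 2).
split.
  apply/forallP => i; rewrite (_ : (fun _ => _) = 0)//.
  by apply/funext => z; rewrite mxE.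
move=> a f g /forallP fP /forallP gP; apply/forallP => i.
rewrite (_ : (fun _ => _) = a *: (fun z => f z 0 i) + (fun z => g z 0 i)).
  exact: LD.
by apply/funext => z; rewrite !mxE.
Qed.

HB.instance Definition _ :=
  GRing.isSubmodClosed.Build R (T -> 'rV[R]_m) sqint sqint_submod.

Record sqintType := Sqint {
  sqint_fun :> T -> 'rV[R]_m ;
  sqint_funP : sqint_fun \in sqint }.
HB.instance Definition _ := [isSub for sqint_fun].
HB.instance Definition _ := [Choice of sqintType by <:].
HB.instance Definition _ := [SubChoice_isSubLmodule of sqintType by <:].

Definition vL2norm (f : sqintType) : R :=
  Num.sqrt (\int[mu]_z \sum_i (f z 0 i) ^+ 2).

Let cmp (f : sqintType) i : LfunType mu (lee1n 2) :=
  Lfun_Sub (lee1n 2) (forallP (sqint_funP f) i).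

Let vL2normE f : vL2norm f = Num.sqrt (\sum_i L2norm (cmp f i) ^+ 2).
Proof.
congr Num.sqrt; rewrite /Rintegral.
under eq_integral do rewrite -sumEFin.
have ifi i : mu.-integrable [set: T] (fun z => (f z 0 i ^+ 2)%:E).
  exact: (Lfun2_integrable_sqr (forallP (sqint_funP f) i)).
rewrite integral_sum//.
rewrite (eq_bigr (fun i => (L2norm (cmp f i) ^+ 2)%:E)) ?sumEFin// => i _.
rewrite -powR_mulrn ?fine_ge0 ?Lnorm_ge0// -poweR_EFin finite_norm_fine.
rewrite powR_Lnorm//.
by apply: eq_integral => z _ /=; rewrite powR_mulrn// real_normK// num_real.
Qed.

Let vL2normZ (a : R) f : vL2norm (a *: f) = `|a| * vL2norm f.
Proof.
rewrite !vL2normE -sqrtr_sqr -sqrtrM ?sqr_ge0// mulr_sumr.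
congr Num.sqrt; apply: eq_bigr => i _.
have -> : cmp (a *: f) i = a *: cmp f i.
  by apply/LfuneqP => z /=; rewrite mxE.
by rewrite L2normZ exprMn real_normK// num_real.
Qed.

Let ler_vL2normD f g : vL2norm (f + g) <= vL2norm f + vL2norm g.
Proof.
rewrite !vL2normE.
apply: le_trans (sqrt_sum_sqrD (fun i => L2norm (cmp f i)) _).
rewrite ler_wsqrtr//; apply: ler_sum => i _.
rewrite ler_sqr ?nnegrE ?addr_ge0 ?fine_ge0 ?Lnorm_ge0//.
have -> : cmp (f + g) i = cmp f i + cmp g i.
  by apply/LfuneqP => z /=; rewrite mxE.
exact: ler_LnormD.
Qed.

Definition vL2seminorm : seminorm sqintType := Seminorm ler_vL2normD vL2normZ.

Definition vL2 : Type := snquot vL2seminorm.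
HB.instance Definition _ := NormedModule.on vL2.

Definition vL2class (f : sqintType) : vL2 := \pi_(snquot vL2seminorm) f.

Lemma vL2class_norm f : `|vL2class f| = vL2norm f.
Proof. exact: pi_snq_norm. Qed.

End L2.

Arguments sqint {d T R} mu m.

Section kolmogorov_width.
Context (R : realType) (X : normedModType R).

Definition subspace_of_dim (n : nat) (V : set X) :=
  exists2 e : 'I_n -> X,
    forall a : 'I_n -> R, \sum_i a i *: e i = 0 -> forall i, a i = 0 &
    V = [set \sum_i a i *: e i | a in [set: 'I_n -> R]].

Definition kolmogorov_width (n : nat) (M : set X) : \bar R :=
  ereal_inf [set ereal_sup [set ereal_inf [set `|u - v|%:E | v in V] | u in M]
            | V in subspace_of_dim n].

End kolmogorov_width.

Section transport.
Context (R : realType).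
Local Notation plane := (measurableTypeR R * measurableTypeR R)%type.

Definition square : set plane := `[-1, 1] `*` `[-1, 1].

Let measurable_square : measurable square.
Proof. exact: measurableX. Qed.

Let square_fin : ((lebesgue_measure \x lebesgue_measure)%E square < +oo)%E.
Proof.
rewrite product_measure1E//= lebesgue_measure_itv/=.
by case: ifPn => _; rewrite -?EFinB -?EFinM ?mule0 ltry.
Qed.

(* Lebesgue measure on [-1, 1]^2, carried by the whole plane: members of
   L2 lebesgue_square are functions on R^2 identified when they agree a.e.
   on the square. *)
Definition lebesgue_square : {finite_measure set plane -> \bar R} :=
  mfrestr measurable_square square_fin.

Definition u0 (r x y : R) : R := if x ^+ 2 + y ^+ 2 <= r ^+ 2 then 1 else 0.

Definition eulerian (r theta t : R) (z : plane) : R :=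
  u0 r (z.1 - t * cos theta) (z.2 - t * sin theta).

Definition lagrangian (r theta t : R) (z : plane) : 'rV[R]_3 :=
  \row_i [:: z.1 + t * cos theta; z.2 + t * sin theta; u0 r z.1 z.2]`_i.

Lemma bounded_Lfun2 (f : plane -> R) (K : R) :
  measurable_fun [set: plane] f -> (forall z, z \in square -> `|f z| <= K) ->
  f \in Lfun lebesgue_square 2.
Proof.
move=> mf fK; rewrite inE; apply/andP; split; rewrite inE//= /finite_norm.
rewrite unlock poweR_lty//=.
apply: (@le_lt_trans _ _ (\int[lebesgue_square]_(z in setT) ((K ^+ 2)%:E))%E).
  apply: ae_ge0_le_integral => //.
  - apply/measurable_EFinP/(measurableT_comp (measurable_powR _)).
    exact: measurableT_comp.
  - by move=> z _; rewrite lee_fin sqr_ge0.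
  - exists (~` square); split.
    + exact: measurableC.
    + by rewrite /= /mfrestr /mrestr setICl measure0.
    + move=> z; apply: contra_not => zsq _; rewrite lee_fin powR_mulrn//.
      rewrite ler_sqr ?nnegrE ?fK ?inE//.
      by rewrite (le_trans (normr_ge0 (f z)))// fK// inE.
rewrite integral_cst// lte_mul_pinfty ?lee_fin ?sqr_ge0//.
by rewrite -ge0_fin_numE// fin_num_measure.
Qed.

Lemma measurable_u0 r (f g : plane -> R) :
  measurable_fun [set: plane] f -> measurable_fun [set: plane] g ->
  measurable_fun [set: plane] (fun z => u0 r (f z) (g z)).
Proof.
move=> mf mg; apply: measurable_fun_if => //.
by apply: measurable_fun_ler => //; apply: measurable_funD;
  exact: measurable_funX.
Qed.

Lemma eulerian_Lfun r theta t : eulerian r theta t \in Lfun lebesgue_square 2.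
Proof.
apply: (@bounded_Lfun2 _ 1).
  by apply: measurable_u0; exact: measurable_funB.
by move=> z _; rewrite /eulerian /u0; case: ifP; rewrite ?normr1// normr0.
Qed.

Lemma lagrangian_sqint r theta t :
  lagrangian r theta t \in sqint lebesgue_square 3.
Proof.
have abs1 (x : R) : x \in `[-1, 1]%classic -> `|x| <= 1.
  by rewrite inE/= in_itv/= ler_norml.
apply/forallP => -[[|[|[|//]]]] i3.
- apply: (@bounded_Lfun2 _ (1 + `|t * cos theta|)).
    under eq_fun do rewrite mxE/=.
    exact: measurable_funD.
  move=> z /set_mem[z1 _]; rewrite mxE/= (le_trans (ler_normD _ _))// lerD2r.
  by rewrite abs1// inE.
- apply: (@bounded_Lfun2 _ (1 + `|t * sin theta|)).
    under eq_fun do rewrite mxE/=.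
    exact: measurable_funD.
  move=> z /set_mem[_ z2]; rewrite mxE/= (le_trans (ler_normD _ _))// lerD2r.
  by rewrite abs1// inE.
- apply: (@bounded_Lfun2 _ 1).
    under eq_fun do rewrite mxE/=.
    exact: measurable_u0.
  by move=> z _; rewrite mxE/= /u0; case: ifP; rewrite ?normr1// normr0.
Qed.

Definition eulerian_manifold (T r : R) : set (L2 lebesgue_square) :=
  [set L2class (Lfun_Sub (lee1n 2) (eulerian_Lfun r p.1 p.2))
  | p in `[0, 2 * pi] `*` `[0, T]].

Definition lagrangian_manifold (T r : R) : set (vL2 lebesgue_square 3) :=
  [set vL2class (Sqint (lagrangian_sqint r p.1 p.2))
  | p in `[0, 2 * pi] `*` `[0, T]].

End transport.

(* Main.v *)
(* Eulerian part: take [theta = 0] and the translates [f_i] of the disk by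
   [i * tau / N], where [tau = min(T, r)] and [N = 2 n].  On the right part of
   the strip [|y| <= r / 2] the differences [f_(i+1) - f_i] are the indicators
   of [N] disjoint crescents of the same area [s = r * tau / N], so they are
   [sqrt s] times an orthonormal family.  If every [f_i] were within [delta] of
   an [n]-dimensional subspace, then testing against the crescents would give
   an [N x N] matrix of rank at most [n] at squared Frobenius distance less than
   [4 * N * delta ^ 2 / s] from the identity; this distance is always at least
   [N - n].
   Lagrangian part: the manifold lies in the span of [(1, 0, 0)], [(0, 1, 0)]
   and [(x, y, u0)], which the [(x ^ k, 0, 0)] extend to subspaces of any
   dimension [n >= 3]. *)

From HB Require Import structures.
Require Import Defs.
From mathcomp Require Import all_boot all_order all_algebra.
From mathcomp Require Import ring lra.
From mathcomp Require Import all_classical all_reals all_analysis.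
From mathcomp Require Import measurable_realfun.
Import Order.TTheory GRing.Theory Num.Theory.
Import numFieldNormedType.Exports.
Local Open Scope ring_scope.

(** * Frobenius distance from the identity to matrices of low rank *)

Section rank_distance.
Context {R : realFieldType}.

Lemma mxtrace_mulmx_tr (m n : nat) (B : 'M[R]_(m, n)) :
  \tr (B *m B^T) = \sum_i \sum_j B i j ^+ 2.
Proof.
apply: eq_bigr => i _; rewrite mxE; apply: eq_bigr => j _.
by rewrite mxE expr2.
Qed.

(** If [x] is a row killed by [K *m K^T], then the sum of squares of the entries of [x *m K] is
    zero, so [x *m K = 0] and freeness gives [x = 0]. *)
Lemma row_free_mulmx_tr_unit (m n : nat) (K : 'M[R]_(m, n)) :
  row_free K -> K *m K^T \in unitmx.
Proof.
move=> Kfree; rewrite -row_free_unit -kermx_eq0; apply/eqP/row_matrixP => i.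
rewrite row0; set x := row i _.
have xKK : x *m (K *m K^T) = 0 by apply/sub_kermxP; rewrite row_sub.
apply: (row_free_inj Kfree); rewrite mul0mx; apply/rowP => j.
have : \tr ((x *m K) *m (x *m K)^T) = 0.
  by rewrite trmx_mul -mulmxA (mulmxA K) mulmxA xKK mul0mx mxtrace0.
rewrite mxtrace_mulmx_tr big_ord1 => xK0; rewrite [RHS]mxE.
apply/eqP; rewrite -sqrf_eq0; apply/eqP.
by apply: (psumr_eq0P _ xK0) => // k _; exact: sqr_ge0.
Qed.

Lemma frobenius_dist_rank_le (N n : nat)
    (A : 'M[R]_(N, n)) (L : 'M[R]_(n, N)) :
  N%:R - n%:R <= \sum_i \sum_j (A *m L - 1%:M) i j ^+ 2.
Proof.
(* [P] is the orthogonal projection onto the left kernel of [A]; with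
   [B = A *m L - 1] one has [P *m B = - P], so that
   [0 <= |B + P|^2 = |B|^2 - \tr P]. *)
have [K Kfree KA] : exists2 K : 'M[R]_(\rank (kermx A), N),
    row_free K & K *m A = 0.
  exists (row_base (kermx A)); first exact: row_base_free.
  by apply/sub_kermxP; rewrite eq_row_base.
pose P := K^T *m invmx (K *m K^T) *m K; pose B := A *m L - 1%:M.
have Ku : K *m K^T \in unitmx by exact: row_free_mulmx_tr_unit.
have PT : P^T = P by rewrite /P !trmx_mul trmxK trmx_inv trmx_mul trmxK mulmxA.
have PP : P *m P = P by rewrite /P -!mulmxA (mulmxA K) mulKVmx// mulmxA.
have trP : \tr P = (\rank (kermx A))%:R.
  by rewrite /P -mulmxA mxtrace_mulC -mulmxA mulVmx// mxtrace1.
have PB : P *m B = - P.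
  by rewrite mulmxBr mulmx1 mulmxA /P -(mulmxA _ K) KA mulmx0 mul0mx sub0r.
have rk : N%:R - n%:R <= (\rank (kermx A))%:R :> R.
  rewrite mxrank_ker natrB ?rank_leq_row// lerD2l lerN2 ler_nat.
  exact: rank_leq_col.
apply: (le_trans rk); rewrite -mxtrace_mulmx_tr -/B -subr_ge0.
suff <- : \tr ((B + P) *m (B + P)^T) = \tr (B *m B^T) - (\rank (kermx A))%:R.
  rewrite mxtrace_mulmx_tr; apply: sumr_ge0 => i _; apply: sumr_ge0 => j _.
  exact: sqr_ge0.
rewrite [(B + P)^T]linearD/= PT mulmxDl !mulmxDr PP !mxtraceD -trP.
rewrite [\tr (B *m P)]mxtrace_mulC PB.
rewrite -[\tr (P *m B^T)]mxtrace_tr trmx_mul trmxK PT.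
rewrite [\tr (B *m P)]mxtrace_mulC PB.
by rewrite linearN/=; ring.
Qed.

End rank_distance.

(** * Lower bounds on widths from test functionals *)

Section width_lower_bound.
Context {R : realType} (V : lmodType R) (p : seminorm V).
Local Notation X := (snquot p).

Lemma pi_snquot_sum (n : nat) (a : 'I_n -> R) (e : 'I_n -> V) :
  \pi_X%qT (\sum_i a i *: e i) = \sum_i a i *: \pi_X%qT (e i) :> X.
Proof.
elim/big_ind2 : _ => [|x1 x2 y1 y2 <- <-|i _].
- by apply: (@addrI _ (\pi_X%qT 0)); rewrite addr0 -pi_snqD addr0.
- exact: pi_snqD.
- exact: pi_snq_scale.
Qed.

Lemma dist_pi_snquot (x y : V) : `|\pi_X%qT x - \pi_X%qT y : X| = p (x - y).
Proof.
suff -> : \pi_X%qT x - \pi_X%qT y = \pi_X%qT (x - y) :> X by exact: pi_snq_norm.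
by apply/eqP; rewrite subr_eq -pi_snqD subrK.
Qed.

(** [l j] abstracts testing against the [j]-th crescent: it maps [f i.+1 - f i] to [s] if [i = j]
    and to 0 otherwise. If all [f i] were close to an [n]-dimensional subspace, the identity of size
    [N] would be close to a matrix that factors through dimension [n]. *)
Lemma kolmogorov_width_ge (N n : nat) (l : 'I_N -> {scalar V}) (f : nat -> V)
    (s delta : R) (M : set X) :
  (0 < N)%N -> 0 < s ->
  (forall h, \sum_j l j h ^+ 2 <= s * p h ^+ 2) ->
  (forall i j, (i <= N)%N -> l j (f i) = s * (j < i)%:R) ->
  (forall i, (i <= N)%N -> M (\pi_X%qT (f i))) ->
  4 * N%:R * delta ^+ 2 <= s * (N%:R - n%:R) ->
  (delta%:E <= kolmogorov_width n M)%E.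
Proof.
move=> N0 s0 bessel lf fM Nd; apply/ereal_infP => _ [W [e _ ->] <-].
rewrite leNgt; apply/negP => sup_lt.
(* Indices beyond [N] get a dummy vector, so that [choice] yields a total function. Representatives
   of [e k] appear because [l j] acts on [V] and not on the quotient. *)
have near i : exists a : 'I_n -> R,
    (i <= N)%N -> p (f i - \sum_k a k *: repr (e k)) < delta.
  have [iN|] := boolP (i <= N)%N; last by exists (fun=> 0).
  have /ereal_inf_lt[_ [_ [a _ <-] <-]] : (ereal_inf
      [set `|\pi_X%qT (f i) - v|%:E | v in
        [set (\sum_i a i *: e i)%R | a in [set: 'I_n -> R]]]%classic
      < delta%:E)%E.
    apply: le_lt_trans sup_lt; apply: ereal_sup_ubound.
    by exists (\pi_X%qT (f i)); first exact: fM.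
  rewrite lte_fin => lt_d; exists a => _; rewrite -dist_pi_snquot.
  by rewrite pi_snquot_sum; under eq_bigr do rewrite reprK.
have [a ha] := choice near.
pose h (i : nat) := (f i.+1 - \sum_k a i.+1 k *: repr (e k)) -
             (f i - \sum_k a i k *: repr (e k)).
have ph (i : 'I_N) : p (h i) ^+ 2 < 4 * delta ^+ 2.
  have h0 : 0 <= p (h i) by exact: snorm_ge0.
  have : p (h i) < delta + delta.
    rewrite (le_lt_trans (ler_snormD _ _ _))// snormN ltrD// ha//.
    exact: ltnW.
  by move=> ?; nra.
(* [A] holds the coefficients of the approximants of the differences, [L] the normalized tests of
   the basis; the product has rank at most [n]. *)
pose A := \matrix_(i < N, k < n) (a i.+1 k - a i k).
pose L := \matrix_(k < n, j < N) (s^-1 * l j (repr (e k))).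
have lh (i j : 'I_N) : l j (h i) = - s * (A *m L - 1%:M) i j.
  have lsum (m : nat) : l j (\sum_k a m k *: repr (e k)) =
      s * \sum_k a m k * (s^-1 * l j (repr (e k))).
    rewrite linear_sum mulr_sumr; apply: eq_bigr => k _.
    by rewrite linearZ/= mulrCA mulVKf// gt_eqF.
  rewrite !linearB/= !lf ?(ltnW (ltn_ord i))// !lsum !mxE.
  under [in RHS]eq_bigr do rewrite !mxE mulrBl.
  rewrite sumrB/= ltnS leq_eqVlt orbC -val_eqE/= [(i : nat) == j]eq_sym.
  by case: ltngtP => _; rewrite ?subrr/=; ring.
(* Contradiction with the rank bound: [s] times the squared distance is at most the sum of the
   [p (h i) ^+ 2], which is less than [4 * N%:R * delta ^+ 2]. Strictness of the sum uses
   [0 < N]. *)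
have := frobenius_dist_rank_le _ _ A L; apply/negP; rewrite -ltNge.
rewrite -(ltr_pM2l s0) (lt_le_trans _ Nd)// mulr_sumr.
have le_i (i : 'I_N) : s * \sum_j (A *m L - 1%:M) i j ^+ 2 < 4 * delta ^+ 2.
  apply: le_lt_trans (ph i); rewrite -(ler_pM2l s0); apply: le_trans (bessel _).
  rewrite !mulr_sumr ler_sum// => j _; rewrite lh le_eqVlt; apply/orP; left.
  by apply/eqP; ring.
rewrite (_ : 4 * _ * _ = \sum_(i < N) 4 * delta ^+ 2).
  by apply: ltr_sum => //; apply/hasP; exists (Ordinal N0);
    rewrite ?mem_index_enum.
by rewrite sumr_const card_ord -mulr_natr; ring.
Qed.

End width_lower_bound.

(** * Bessel's inequality and the inner product on square integrable functions *)

Lemma bessel_le (R : realFieldType) (V : lmodType R) (B : V -> {scalar V})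
    (N : nat) (g : 'I_N -> V) (s : R) (h : V) :
  (forall x y, B x y = B y x) -> (forall x, 0 <= B x x) -> 0 < s ->
  (forall i j, B (g i) (g j) = s * (i == j)%:R) ->
  \sum_j B (g j) h ^+ 2 <= s * B h h.
Proof.
move=> BC B0 s0 gg.
(* [G] is [s] times the projection of [h] onto the span of the [g j]. With D the sum to bound,
   expanding [0 <= B (s *: h - G) (s *: h - G)] gives [0 <= s * (s * B h h - D)]. *)
have [G GE] : exists G : V, G = \sum_j B (g j) h *: g j by eexists.
have BG x : B x G = \sum_j B (g j) h * B x (g j).
  by rewrite GE linear_sum; apply: eq_bigr => j _; rewrite linearZ.
have hG : B h G = \sum_j B (g j) h ^+ 2.
  by rewrite BG; apply: eq_bigr => j _; rewrite BC expr2.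
have GG : B G G = s * \sum_j B (g j) h ^+ 2.
  rewrite BG mulr_sumr; apply: eq_bigr => j _.
  rewrite [B G _]BC BG (bigD1 j)//= big1 => [|i ij].
    by rewrite gg eqxx/=; ring.
  by rewrite gg eq_sym (negbTE ij) !mulr0.
have Bsub x : B x (s *: h - G) = s * B x h - B x G.
  by rewrite linearB/= linearZ.
have := B0 (s *: h - G); rewrite Bsub.
rewrite ![B (_ - _) _]BC !Bsub [B G h]BC hG GG.
by set D := \sum_j _ => D0; rewrite -subr_ge0 -(pmulr_rge0 _ s0); lra.
Qed.

Section L2_inner_product.
Context {d} {T : measurableType d} {R : realType}.
Context {mu : {measure set T -> \bar R}}.
Local Notation L := (LfunType mu (lee1n 2)).

Definition L2dot (g f : L) : R := (\int[mu]_x (g x * f x))%R.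

Lemma integrable_L2dot (g f : L) :
  mu.-integrable [set: T] (EFin \o (fun x => g x * f x)).
Proof.
by apply/Lfun1_integrable; exact: (Lfun2_mul_Lfun1 (LfunP g) (LfunP f)).
Qed.

Lemma L2dotC (g f : L) : L2dot g f = L2dot f g.
Proof. by apply: eq_Rintegral => x _; rewrite mulrC. Qed.

Let L2dot_scalar (g : L) : scalar (L2dot g).
Proof.
move=> a f h; rewrite /L2dot -RintegralZl//; last exact: integrable_L2dot.
rewrite -RintegralD//; last 2 first.
- by apply: (integrableZl _ a (integrable_L2dot g f)).
- exact: integrable_L2dot.
by apply: eq_Rintegral => x _ /=; rewrite mulrDr mulrCA.
Qed.

HB.instance Definition _ (g : L) :=
  GRing.isLinear.Build R L R *%R (L2dot g) (L2dot_scalar g).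

Lemma L2norm_sqr (f : L) : L2norm f ^+ 2 = L2dot f f.
Proof.
apply: EFin_inj; rewrite -powR_mulrn ?fine_ge0 ?Lnorm_ge0//.
rewrite -poweR_EFin finite_norm_fine powR_Lnorm// /L2dot /Rintegral fineK.
  apply: eq_integral => z _ /=.
  by rewrite powR_mulrn// real_normK ?num_real// expr2.
exact: (integrable_fin_num _ (integrable_L2dot f f)).
Qed.

Lemma L2_bessel (N : nat) (g : 'I_N -> L) (s : R) (h : L) : 0 < s ->
  (forall i j, L2dot (g i) (g j) = s * (i == j)%:R) ->
  \sum_j L2dot (g j) h ^+ 2 <= s * L2norm h ^+ 2.
Proof.
move=> s0 gg; rewrite L2norm_sqr.
apply: (@bessel_le R L (fun f => L2dot f)) => //; first exact: L2dotC.
by move=> f /=; rewrite -L2norm_sqr sqr_ge0.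
Qed.

End L2_inner_product.

(** * Measurability and area of the crescents *)

Section crescent.
Context {R : realType}.
Local Open Scope classical_set_scope.
Local Notation plane := (measurableTypeR R * measurableTypeR R)%type.
Local Notation leb := (@lebesgue_measure R).

(* The part in the strip [|y| <= r / 2] of the disk of radius [r] centered at
   [(b, 0)] outside the one centered at [(a, 0)], when [a <= b] are close. *)
Definition crescent (r a b : R) : set plane :=
  [set z | `|z.2| <= r / 2 /\ a + Num.sqrt (r ^+ 2 - z.2 ^+ 2) < z.1 /\
           z.1 <= b + Num.sqrt (r ^+ 2 - z.2 ^+ 2)].

Lemma measurable_crescent (r a b : R) : measurable (crescent r a b).
Proof.
have mq c : measurable_fun [set: plane]
    (fun z : plane => c + Num.sqrt (r ^+ 2 - z.2 ^+ 2)).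
  apply: measurable_funD => //.
  apply: (measurableT_comp (continuous_measurable_fun (@sqrt_continuous R))).
  by apply: measurable_funB => //; exact: measurable_funX.
have mset (P : plane -> bool) : measurable_fun [set: plane] P ->
    measurable [set z | P z].
  move=> mP; rewrite -[X in measurable X]setTI.
  exact: (mP measurableT [set true]).
apply: measurableI.
  apply: mset; apply: measurable_fun_ler => //.
  exact: (measurableT_comp (@normr_measurable _ _)).
apply: measurableI.
  by apply: mset; apply: measurable_fun_ltr.
by apply: mset; apply: measurable_fun_ler.
Qed.

(** Uniqueness of the product measure permits slicing along horizontal lines, on which a crescent is
    an interval. *)
Lemma product_lebesgueE (A : set plane) : measurable A ->
  (leb \x leb)%E A = (\int[leb]_y leb (ysection A y))%E.
Proof.
by move=> mA; rewrite (product_measure_unique (product_measure2E leb leb)).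
Qed.

Lemma sqrt_bounds (r y : R) : 0 < r -> `|y| <= r / 2 ->
  r / 2 <= Num.sqrt (r ^+ 2 - y ^+ 2) <= r.
Proof.
move=> r0; rewrite ler_norml => /andP[yr1 yr2].
have yr : y ^+ 2 <= (r / 2) ^+ 2 by nra.
have q2 : 0 <= r ^+ 2 - y ^+ 2 by nra.
have r20 : 0 <= r / 2 by lra.
have := sqr_ge0 y; have := sqr_ge0 r => r2 y2.
apply/andP; split.
  by rewrite -(@ler_pXn2r _ 2)// ?nnegrE ?sqrtr_ge0// sqr_sqrtr//; nra.
by rewrite -(@ler_pXn2r _ 2)// ?nnegrE ?sqrtr_ge0 ?(ltW r0)// sqr_sqrtr//; nra.
Qed.

(** Every slice at height [|y| <= r / 2] is an interval of length [b - a], and these heights fill a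
    length [r]; [b + r <= 1] keeps the crescent inside the square. *)
Lemma lebesgue_square_crescent (r a b : R) : 0 < r -> 0 <= a -> a <= b ->
  b + r <= 1 -> lebesgue_square R (crescent r a b) = (r * (b - a))%:E.
Proof.
move=> r0 a0 ab br1.
rewrite /lebesgue_square/= /mfrestr /mrestr setIidl; last first.
  move=> z [zr [az zb]]; have /andP[q1 q2] := sqrt_bounds _ _ r0 zr.
  by move: zr; rewrite ler_norml => /andP[? ?]; split;
    rewrite /= in_itv/=; apply/andP; split; lra.
rewrite product_lebesgueE; last exact: measurable_crescent.
transitivity (\int[leb]_y ((b - a)%:E * (\1_(`[(- (r / 2)), r / 2]) y)%:E))%E.
  apply: eq_integral => y _; rewrite indicE.
  have -> : (y \in `[(- (r / 2)), r / 2]) = (`|y| <= r / 2).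
    by rewrite mem_setE in_itv/= ler_norml.
  have [yr|yr] := boolP (`|y| <= r / 2).
    rewrite (_ : ysection _ _ = `]a + Num.sqrt (r ^+ 2 - y ^+ 2),
        b + Num.sqrt (r ^+ 2 - y ^+ 2)]); last first.
      apply/seteqP; split => x; rewrite ysectionE/= in_itv/=.
        by move=> [_ [-> ->]].
      by move=> /andP[].
    rewrite lebesgue_measure_itv/= lte_fin ltrD2r mule1.
    by have [_|ba] := ltP a b; rewrite -?EFinD; congr EFin; lra.
  rewrite mule0 (_ : ysection _ _ = set0) ?measure0//.
  apply/seteqP; split => x //; rewrite ysectionE/= => -[].
  by move=> yr'; rewrite yr' in yr.
rewrite ge0_integralZl//; last by rewrite lee_fin subr_ge0.
  rewrite integral_indic// setIT/= lebesgue_measure_itv/= lte_fin.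
  by rewrite ifT ?gtrN ?divr_gt0// -EFinD -EFinM; congr EFin; lra.
exact/measurable_EFinP.
Qed.

End crescent.

(** * Lower bound for the Eulerian manifold *)

Section eulerian.
Context {R : realType}.
Local Open Scope classical_set_scope.
Local Notation plane := (measurableTypeR R * measurableTypeR R)%type.
Local Notation mu := (lebesgue_square R).
Local Notation L := (LfunType mu (lee1n 2)).

(** Let [q] be the half chord at height [z.2]. If [t <= a], then [z.1 - t > q]. If [b <= t], then
    [z.1 - t <= q], and also [z.1 - t > q - r >= - q] because [q >= r / 2] in the strip. *)
Lemma u0_crescent (r a b t : R) (z : plane) :
  0 < r -> a <= b -> 0 <= a -> t <= r -> crescent r a b z ->
  (b <= t) || (t <= a) -> u0 r (z.1 - t) z.2 = (b <= t)%R%:R.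
Proof.
move=> r0 ab a0 tr [zr [az zb]] bt; have /andP[q1 q2] := sqrt_bounds _ _ r0 zr.
have q2E : Num.sqrt (r ^+ 2 - z.2 ^+ 2) ^+ 2 = r ^+ 2 - z.2 ^+ 2.
  rewrite sqr_sqrtr// subr_ge0 -real_normK ?num_real//.
  by have := normr_ge0 z.2; nra.
move: az zb q1 q2 q2E; set q := Num.sqrt _ => az zb q1 q2 q2E.
rewrite /u0; have [bt1|tb] := leP b t; last have {}bt : t <= a by lra.
  by rewrite ifT//; nra.
by rewrite ifF//; apply/negbTE; rewrite -ltNge; nra.
Qed.

Lemma indic_crescent_Lfun (r a b : R) :
  (\1_(crescent r a b) : plane -> R) \in Lfun mu 2.
Proof.
apply: (@bounded_Lfun2 _ _ 1) => [|z _].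
  exact: (measurable_indic (measurable_crescent r a b)).
by rewrite indicE; case: (_ \in _); rewrite ?normr1 ?normr0.
Qed.

Lemma L2dot_indic (f g : L) (A : set plane) : measurable A ->
  (forall z, f z * g z = \1_A z) -> L2dot f g = fine (mu A).
Proof.
move=> mA fg; rewrite /L2dot /Rintegral; congr fine.
by under eq_integral do rewrite fg; rewrite integral_indic// setIT.
Qed.

Lemma kolmogorov_width_eulerian_ge (T r : R) (n : nat) :
  0 < T -> 0 < r -> r < 1 - T -> (1 <= n)%N ->
  ((Num.sqrt (r * Num.min T r) / 4 * n%:R `^ (- 2^-1))%:E <=
          kolmogorov_width n (eulerian_manifold T r))%E.
Proof.
(* [tau <= T] makes the times admissible and, with [r < 1 - T], keeps the disks in the square;
   [tau <= r] is what [u0_crescent] asks for. *)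
move=> T0 r0 rT n0; set tau := Num.min T r.
have tau0 : 0 < tau by rewrite lt_min T0.
have [tauT taur] : tau <= T /\ tau <= r by split; rewrite ge_min lexx ?orbT.
have nR0 : 0 < n%:R :> R by rewrite ltr0n.
(* With [N = 2 n] and [s = r * tau / N], the condition [4 * N * delta ^ 2 <= s * (N - n)] becomes
   [delta ^ 2 <= r * tau / (16 * n)]; the constant of the statement attains equality. *)
pose N := (n + n)%N; pose h := tau / N%:R.
have N0 : (0 < N)%N by rewrite addn_gt0 n0.
have NR0 : 0 < N%:R :> R by rewrite ltr0n.
have h0 : 0 < h by rewrite divr_gt0.
have iN (i : nat) : (i <= N)%N -> i%:R * h <= tau.
  move=> iN; rewrite /h mulrCA ler_piMr ?(ltW tau0)// ler_pdivrMr//.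
  by rewrite mul1r ler_nat.
pose f i : L := Lfun_Sub (lee1n 2) (eulerian_Lfun r 0 (i%:R * h)).
pose S (j : 'I_N) := crescent r (j%:R * h) (j.+1%:R * h).
pose g (j : 'I_N) : L :=
  Lfun_Sub (lee1n 2) (indic_crescent_Lfun r (j%:R * h) (j.+1%:R * h)).
have muS j : fine (mu (S j)) = r * h.
  rewrite lebesgue_square_crescent//.
  - by rewrite /= -natr1; ring.
  - by rewrite mulr_ge0 ?(ltW h0).
  - by rewrite ler_pM2r// ler_nat.
  - by have := iN j.+1 (ltn_ord j); lra.
have Sf i (j : 'I_N) z : (i <= N)%N -> S j z -> f i z = (j < i)%:R.
  move=> iN' Sz; rewrite /= /eulerian cos0 sin0 mulr1 mulr0 subr0.
  rewrite (u0_crescent _ _ _ _ _ _ _ _ _ Sz) ?ler_pM2r ?ler_nat//.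
  - by rewrite mulr_ge0 ?(ltW h0).
  - exact: le_trans (iN _ iN') taur.
  - by case: ltnP.
have gf i (j : 'I_N) : (i <= N)%N -> L2dot (g j) (f i) = r * h * (j < i)%:R.
  move=> iN'; have [ji|ij] := ltnP j i.
    rewrite (L2dot_indic _ _ (S j)) ?muS ?mulr1//.
      exact: measurable_crescent.
    move=> z; rewrite [g j z]/= indicE; have [zS|] := boolP (z \in S j).
      by rewrite (Sf _ j) ?ji ?mulr1// -in_setE.
    by rewrite mul0r.
  rewrite (L2dot_indic _ _ set0) ?measure0 ?mulr0//.
  move=> z; rewrite [g j z]/= !indicE in_set0; have [zS|] := boolP (z \in S j).
    by rewrite (Sf _ j) ?ltnNge ?ij ?mulr0// -in_setE.
  by rewrite mul0r.
(* Crescents are open on the left and closed on the right, so consecutive ones abut without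
   overlapping. *)
have Sdisj (i j : 'I_N) z : (i < j)%N -> S i z -> S j z -> False.
  move=> ij [_ [_ zi]] [_ [zj _]]; have := lt_le_trans zj zi.
  by apply/negP; rewrite -leNgt lerD2r ler_pM2r// ler_nat.
have gg i j : L2dot (g i) (g j) = r * h * (i == j)%:R.
  have [<-|ij] := eqVneq i j.
    rewrite (L2dot_indic _ _ (S i)) ?muS ?mulr1//.
      exact: measurable_crescent.
    move=> z; rewrite [g i z]/= !indicE.
    by case: (_ \in _); rewrite ?mulr1 ?mulr0.
  rewrite (L2dot_indic _ _ set0) ?measure0 ?mulr0//.
  move=> z; rewrite /= !indicE in_set0.
  have [/set_mem zi|] := boolP (z \in _); last by rewrite mul0r.
  have [/set_mem zj|] := boolP (z \in _); last by rewrite mulr0.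
  by move: ij; rewrite neq_ltn => /orP[] ij;
    [case: (Sdisj _ _ _ ij zi zj) | case: (Sdisj _ _ _ ij zj zi)].
apply: (@kolmogorov_width_ge R L (L2seminorm mu) N n
  (fun j => L2dot (g j)) f (r * h)) => //.
- by rewrite mulr_gt0.
- by move=> k; apply: L2_bessel => //; rewrite mulr_gt0.
- move=> i iN'; exists (0, i%:R * h) => //; split; rewrite /= in_itv/=.
    by rewrite lexx mulr_ge0// pi_ge0.
  by rewrite mulr_ge0 ?(ltW h0)// (le_trans (iN _ iN')).
- have pw : (n%:R `^ (- 2^-1)) ^+ 2 = n%:R^-1 :> R.
    rewrite -powR_mulrn ?powR_ge0// -powRrM mulNr mulVf//.
    by rewrite powR_inv1 ?(ltW nR0).
  rewrite exprMn expr_div_n sqr_sqrtr ?mulr_ge0 ?(ltW r0) ?(ltW tau0)// pw.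
  rewrite /h /N natrD le_eqVlt; apply/orP; left; apply/eqP; field.
  by rewrite gt_eqF//=; lra.
Qed.

End eulerian.

(** * Zero widths, and vector fields of zero norm *)

Lemma kolmogorov_width_eq0 (R : realType) (X : normedModType R) (n : nat)
    (M V : set X) :
  (M !=set0)%classic -> subspace_of_dim n V -> (M `<=` V)%classic ->
  kolmogorov_width n M = 0%E.
Proof.
move=> [w Mw] Vn MV; apply/eqP; rewrite eq_le; apply/andP; split.
  apply: ge_ereal_inf; eexists; first by exists V.
  apply: ge_ereal_sup => _ [u Mu <-]; apply: ge_ereal_inf.
  by eexists; [exists u; [exact: MV|reflexivity]|rewrite subrr normr0].
(* The lower bound needs the point [w]: a supremum over the empty set would be [-oo]. *)
apply/ereal_infP => _ [W _ <-].
apply: (@le_trans _ _ (ereal_inf [set `|w - v|%:E | v in W]%classic)).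
  by apply/ereal_infP => _ [v _ <-]; rewrite lee_fin.
by apply: ereal_sup_ubound; exists w.
Qed.

Section vL2.
Context {d} {T : measurableType d} {R : realType}.
Context {mu : {measure set T -> \bar R}} {m : nat}.

Lemma vL2norm_eq0 (f : sqintType mu m) :
  vL2norm f = 0 -> {ae mu, forall z, f z = 0}.
Proof.
have intf (i : 'I_m) :
    mu.-integrable [set: T] (EFin \o (fun z => f z 0 i ^+ 2)).
  by apply: Lfun2_integrable_sqr; exact: (forallP (sqint_funP f) i).
have sum0 z : 0 <= \sum_i f z 0 i ^+ 2.
  by apply: sumr_ge0 => i _; exact: sqr_ge0.
have int : mu.-integrable [set: T] (EFin \o (fun z => \sum_i f z 0 i ^+ 2)).
  rewrite [X in _.-integrable _ X](_ : _ =
      (fun z => \sum_(i <- index_enum 'I_m) (f z 0 i ^+ 2)%:E)%E).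
    by apply: integrable_sum => // i _; exact: intf.
  by apply/funext => z; rewrite /= sumEFin.
rewrite /vL2norm => /eqP; rewrite sqrtr_eq0 => le0.
have int0 : (\int[mu]_z `|(\sum_i f z 0 i ^+ 2)%:E| = 0)%E.
  under eq_integral do rewrite gee0_abs ?lee_fin//.
  rewrite -[LHS]fineK; last exact: integrable_fin_num int.
  congr EFin; apply/eqP; rewrite eq_le le0; exact: Rintegral_ge0.
have mf := measurable_int _ int.
have := (ae_eq_integral_abs mu measurableT mf).1 int0.
apply: filterS => z /(_ Logic.I)/= [fz]; apply/rowP => i; rewrite mxE.
apply/eqP; rewrite -sqrf_eq0; apply/eqP.
by apply: (psumr_eq0P _ fz) => // j _; exact: sqr_ge0.
Qed.

Lemma sqint_sumE (n : nat) (a : 'I_n -> R) (f : 'I_n -> sqintType mu m) z i :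
  (\sum_k a k *: f k : sqintType mu m) z 0 i = \sum_k a k * f k z 0 i.
Proof.
by elim/big_ind2 : _ => [|x1 x2 y1 y2 <- <-|k _]; rewrite /= !mxE.
Qed.

End vL2.

(** * Subspaces containing the Lagrangian manifold *)

Section lagrangian.
Context {R : realType}.
Local Open Scope classical_set_scope.
Local Notation plane := (measurableTypeR R * measurableTypeR R)%type.
Local Notation mu := (lebesgue_square R).

Lemma finite_poly_roots (p : {poly R}) :
  p != 0 -> finite_set [set x | p.[x] = 0].
Proof.
move=> p_neq0; apply: contrapT => /(@infinite_set_fset _ _ (size p))[B Bp].
apply/negP; rewrite -ltnNge; apply: max_poly_roots => //.
  by apply/allP => x xB; apply/eqP; exact: Bp.
exact: finmap.fset_uniq.
Qed.

(** A nonzero polynomial in the first coordinate vanishes on finitely many vertical lines only, a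
    null set, whereas the square has positive measure. *)
Lemma poly_ae_eq0 (p : {poly R}) :
  {ae mu, forall z : plane, p.[z.1] = 0} -> p = 0.
Proof.
move=> p_ae0; apply/eqP/negP => /negP p_neq0.
have rootsC := finite_set_countable (finite_poly_roots p p_neq0).
have mroots : measurable ([set x | p.[x] = 0] : set (measurableTypeR R)).
  exact: countable_measurable.
have roots0 : mu.-negligible ([set x | p.[x] = 0] `*` setT).
  apply/negligibleP; first exact: measurableX.
  rewrite /= /mfrestr /mrestr -setXI setTI.
  rewrite [LHS]product_measure1E//; last exact: measurableI.
  rewrite [X in (X * _)%E](_ : _ = 0%E) ?mul0e//.
  apply: countable_lebesgue_measure0; apply: sub_countable rootsC.
  by apply: subset_card_le; exact: subIsetl.
have : mu.-negligible [set: plane].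
  apply: negligibleS (negligibleU p_ae0 roots0) => z _ /=.
  by have [pz|pz] := pselect (p.[z.1] = 0); [right|left].
move=> /(measure_negligible measurableT); apply/eqP.
rewrite /= /mfrestr /mrestr setTI [X in X != _]product_measure1E//=.
by rewrite lebesgue_measure_itv/= lte_fin ifT ?gtrN// -EFinB -EFinM eqe; lra.
Qed.

(* The vectors 0 and 2 are the directions of translation, and the vector 1 is
   the Lagrangian solution at [t = 0]. *)
Definition lag_basis (r : R) (k : nat) (z : plane) : 'rV[R]_3 :=
  \row_i [:: if k == 2 then 0 else z.1 ^+ k;
             if k == 1 then z.2 else (k == 2)%:R;
             if k == 1 then u0 r z.1 z.2 else 0]`_i.

Lemma lag_basis_sqint (r : R) (k : nat) : lag_basis r k \in sqint mu 3.
Proof.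
have abs1 (x : R) : x \in `[-1, 1]%classic -> `|x| <= 1.
  by rewrite inE/= in_itv/= ler_norml.
apply/forallP => i.
have -> : (fun z : plane => lag_basis r k z 0 i) = (fun z : plane =>
   [:: if k == 2 then 0 else z.1 ^+ k;
             if k == 1 then z.2 else (k == 2)%:R;
             if k == 1 then u0 r z.1 z.2 else 0]`_i).
  by apply/funext => z; rewrite mxE.
apply: (@bounded_Lfun2 _ _ 1).
  case: i => [[|[|[|//]]] _] /=; case: eqP => _ /=//.
  - exact: measurable_funX.
  - exact: measurable_snd.
  - exact: measurable_u0.
move=> z /set_mem[/= z1 z2].
case: i => [[|[|[|//]]] _] /=; case: ifP => _; rewrite ?normr0//.
- by rewrite normrX exprn_ile1// abs1// inE.
- by rewrite abs1// inE.
- by case: eqP; rewrite ?normr0 ?normr1.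
- by rewrite /u0; case: ifP; rewrite ?normr1// normr0.
Qed.

Let E (r : R) k : vL2 mu 3 := vL2class (Sqint (lag_basis_sqint r k)).

(** The first components are the distinct monomials [x ^ k], except for a zero at [k = 2]. Comparing
    them as polynomials kills every coefficient but that of index 2, which the second component then
    kills. *)
Lemma lag_basis_free (r : R) n (a : 'I_n -> R) :
  \sum_i a i *: E r i = 0 -> forall i, a i = 0.
Proof.
move=> aE.
have ae0 (j : 'I_3) :
    {ae mu, forall z : plane, \sum_i a i * lag_basis r i z 0 j = 0}.
  have /vL2norm_eq0 : vL2norm (\sum_i a i *: Sqint (lag_basis_sqint r i)) = 0.
    by rewrite -vL2class_norm /vL2class pi_snquot_sum aE normr0.
  by apply: filterS => z /rowP/(_ j); rewrite sqint_sumE mxE.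
have poly0 (b : 'I_n -> R) (j : 'I_3) :
    (forall z, \sum_i a i * lag_basis r i z 0 j = \sum_i b i * z.1 ^+ i) ->
    forall i, b i = 0.
  move=> ab i; have /polyP/(_ i) : \sum_i b i *: 'X^i = 0 :> {poly R}.
    apply: poly_ae_eq0; move: (ae0 j); apply: filterS => z; rewrite ab.
    rewrite horner_sum => e; rewrite -[RHS]e; apply: eq_bigr => k _.
    by rewrite hornerZ hornerXn.
  rewrite coef_sum coef0 (bigD1 i)//= big1 ?addr0.
    by rewrite coefZ coefXn eqxx mulr1.
  move=> k ki; rewrite coefZ coefXn eq_sym -val_eqE/= in ki *.
  by rewrite (negbTE ki) mulr0.
have a0 (i : 'I_n) : i != 2 :> nat -> a i = 0.
  move=> i2.
  have := poly0 (fun i : 'I_n => if i == 2 :> nat then 0 else a i) 0 _ i.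
  rewrite (negbTE i2); apply => z; apply: eq_bigr => k _; rewrite mxE/=.
  by case: eqP; rewrite ?mulr0 ?mul0r.
(* With the other coefficients gone, the second component is the constant [a i], read as a constant
   polynomial. *)
move=> i; have [i2|] := eqVneq (i : nat) 2; last exact: a0.
apply/eqP; rewrite -polyC_eq0; apply/eqP; apply: poly_ae_eq0.
move: (ae0 1); apply: filterS => z; rewrite (bigD1 i)//= big1 => [|k ki].
  by rewrite mxE/= i2/= addr0 mulr1 hornerC.
by rewrite a0 ?mul0r// -i2.
Qed.

Lemma kolmogorov_width_lagrangian (T r : R) (n : nat) : 0 <= T -> (3 <= n)%N ->
  kolmogorov_width n (lagrangian_manifold T r) = 0%E.
Proof.
move=> T0 n3; pose e (i : 'I_n) := E r i.
apply: (@kolmogorov_width_eq0 _ _ _ _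
  [set \sum_i a i *: e i | a in [set: 'I_n -> R]]).
- eexists; exists (0, 0) => //; split; rewrite /= in_itv/= lexx//=.
  by rewrite mulr_ge0// pi_ge0.
- by exists e => // a; exact: lag_basis_free.
(* The order of [c] follows [lag_basis]; beyond index 2 the default of [nth] supplies zero
   coefficients. *)
move=> _ [[theta t] _ <-]/=; pose c := [:: t * cos theta; 1; t * sin theta].
exists (fun i : 'I_n => c`_i) => //.
rewrite /e /E /vL2class -pi_snquot_sum; congr (\pi_(_)%qT _).
apply: val_inj; apply/funext => z; apply/rowP => j; rewrite [LHS]sqint_sumE.
case: n n3 {e} => [|[|[|n]]]// _; rewrite !big_ord_recl/= big1 => [|i _].
  rewrite !mxE/=; case: j => [[|[|[|//]]] ?] /=; ring.
by rewrite nth_default// mul0r.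
Qed.

End lagrangian.

Theorem theorem2 (R : realType) (T r : R) (T_gt0 : 0 < T) (r_gt0 : 0 < r)
    (r_lt : r < 1 - T) :
  (exists2 c : R, 0 < c &
     forall n : nat, (1 <= n)%N ->
       ((c * n%:R `^ (- 2^-1))%:E <=
          kolmogorov_width n (eulerian_manifold T r))%E) /\
  (forall n : nat, (3 <= n)%N ->
     kolmogorov_width n (lagrangian_manifold T r) = 0%E).
Proof.
split; last by move=> n; apply: kolmogorov_width_lagrangian; exact: ltW.
exists (Num.sqrt (r * Num.min T r) / 4).
  by rewrite divr_gt0// sqrtr_gt0 mulr_gt0// lt_min T_gt0.
by move=> n; exact: kolmogorov_width_eulerian_ge.
Qed.
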